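(* The following two statements are equivalent. (i) (Zaremba's Conjecture) There exists an absolute constant $A$ such that for all $N\in\mathbb{N}$ there is an $a\in\mathbb{N}$ relatively prime to $N$ such that all continued fraction coefficients of $\frac aN$ are less than $A$. (ii) There is a positive constant $C$ such that for all $n\in\mathbb{N}$ there exists some $p\in\mathbb{N}$, co-prime to $n$, such that the rank-1 lattice $P_n=\{(\{kp/n\},k/n): 0\le k<n\}\subseteq[0,1]^2$ satisfies $$\mathrm{disp}_{\mathbb{T}}(P_n)<\frac Cn .$$
   Context: $\mathbb{N}$ is the set of positive integers and $\{x\}$ denotes the fractional part of $x$. For a finite set $P\subset[0,1)^2$, the periodic dispersion $\mathrm{disp}_{\mathbb{T}}(P)$ is the largest area of an empty open axis-parallel box when boxes are allowed to wrap around the unit square viewed as the torus $\mathbb{R}^2/\mathbb{Z}^2$. That is, it is the supremum of $(y_1-x_1)(y_2-x_2)$ over all boxes $(x_1,y_1)\times(x_2,y_2)\subset\mathbb{R}^2$ with $0<y_i-x_i\le1$ for $i=1,2$ that contain no point of $P+\mathbb{Z}^2$. *)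

(* Defs.v *)
From mathcomp Require Import all_boot all_order all_algebra.
From mathcomp Require Import boolp classical_sets reals.

Set Implicit Arguments.
Unset Strict Implicit.
Unset Printing Implicit Defensive.

Import Order.TTheory GRing.Theory Num.Theory.

Local Open Scope classical_set_scope.
Local Open Scope ring_scope.

Definition frac_part (R : realType) (x : R) : R := x - (Num.floor x)%:~R.

(* The i-th complete quotient of x: x_0 = x and x_(i+1) = 1 / {x_i}.  It is
   [None] once the expansion has stopped, i.e. after some x_j is an integer. *)
Definition complete_quotient (R : realType) (x : R) (i : nat) : option R :=
  iter i (obind (fun y => if frac_part y == 0 then None else Some (frac_part y)^-1))
    (Some x).

(* For a noninteger rational x this is the canonical (Euclidean) expansion,
   whose last coefficient is at least 2. *)
Definition cf_coef (R : realType) (x : R) (i : nat) : option int :=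
  omap (fun y => Num.floor y) (complete_quotient x i).

Definition in_open_box (R : realType) (x y u : R * R) : Prop :=
  (x.1 < u.1 < y.1) /\ (x.2 < u.2 < y.2).

Definition periodize (R : realType) (P : set (R * R)) : set (R * R) :=
  [set u | exists2 v, P v & exists k l : int, u = (v.1 + k%:~R, v.2 + l%:~R)].

Definition empty_periodic_box (R : realType) (P : set (R * R)) (x y : R * R) :
    Prop :=
  [/\ 0 < y.1 - x.1 <= 1, 0 < y.2 - x.2 <= 1 &
      forall u, periodize P u -> ~ in_open_box x y u].

(* The areas lie in ]0, 1]; for finite P there are empty boxes, so this real
   supremum is a genuine one. *)
Definition periodic_dispersion (R : realType) (P : set (R * R)) : R :=
  sup [set s | exists x y : R * R,
    empty_periodic_box P x y /\ s = (y.1 - x.1) * (y.2 - x.2)].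

Definition rank1_lattice (R : realType) (n p : nat) : set (R * R) :=
  [set (frac_part ((k * p)%N%:R / n%:R), k%:R / n%:R)
    | k in [set k : nat | (k < n)%N]].
Arguments rank1_lattice : clear implicits.

(* Main.v *)
Require Import Defs.
From mathcomp Require Import all_boot all_order all_algebra.
From mathcomp Require Import boolp classical_sets reals.
From mathcomp Require Import ring lra zify.

(** Up to a rescaling by [n], the periodized point set is the planar lattice
    [L] of the integer pairs [(X, Y)] with [X = p Y] modulo [n], whose
    determinant is [n].  Euclid's algorithm on [(n, p mod n)] produces a chain
    of bases of [L]: at each step the consecutive remainders [d > d'] and the
    corresponding convergent denominators [q <= q'] give the basis
    [(e d, q)], [(- e d', q')] for a sign [e], with [d q' + d' q = n]
    ([euclid_basis], [euclid_basisS]).  The quotients [d %/ d'] met on the way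
    are the continued fraction coefficients of [p / n], apart from the first
    one ([cf_coef_natr_divS]).

    Bounded coefficients give small dispersion.  A box that is wider than
    [d + d'] and higher than [q + q'] contains a lattice point, because it
    contains a fundamental parallelogram of the basis ([box_meets_basis]).
    Given an empty box, run the algorithm until its width first exceeds
    the sum of the two current remainders.  One step earlier the width was at
    most [d + d' <= 2 d], and the height is now at most the sum of the next two
    denominators, [q' + (q + (d %/ d') q')], which is [O(q')] when the
    coefficients are bounded.  Since [d q' <= n], the area is [O(n)], that is,
    [O(1 / n)] before rescaling ([empty_box_area_le]).

    Small dispersion gives bounded coefficients.  For a lattice vector [(X, Y)],
    the determinant of [(X, Y)] with any lattice vector is a multiple of [n],
    so [L] avoids the open strip where this determinant lies strictly between
    [0] and [n].  A box inscribed in that strip has sides [n / (2 |Y|)] and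
    [n / (2 |X|)] ([empty_periodic_box_of_vector]).  Applied to
    [(- e d', q')], it shows that the dispersion is at least
    [1 / (4 d' q')], whereas [(d %/ d') d' q' <= d q' <= n]; hence a dispersion
    below [C / n] forces [d %/ d' < 4 C] ([cf_coef_euclid_basis_lt]). *)

Import Order.TTheory GRing.Theory Num.Theory.

Local Open Scope ring_scope.

(** * Euclid's algorithm and continued fractions *)

Section ContinuedFraction.
Variable R : realType.

Lemma floor_natr_div (m d : nat) : (0 < d)%N ->
  Num.floor (m%:R / d%:R : R) = (m %/ d)%N%:Z.
Proof.
move=> d0; have dR : 0 < d%:R :> R by rewrite ltr0n.
apply: floor_def; rewrite ler_pdivlMr// ltr_pdivrMr//.
rewrite -[_ + 1]/((m %/ d)%:Z + 1%:Z) -PoszD.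
rewrite -!pmulrn -!natrM ler_nat ltr_nat leq_divM /=.
by rewrite addn1 ltn_ceil.
Qed.

Lemma frac_part_natr_div (m d : nat) : (0 < d)%N ->
  frac_part (m%:R / d%:R : R) = (m %% d)%N%:R / d%:R.
Proof.
move=> d0; have dR : d%:R != 0 :> R by rewrite pnatr_eq0 -lt0n.
rewrite /frac_part floor_natr_div// -pmulrn {1}(divn_eq m d) natrD natrM.
by field.
Qed.

Lemma cf_coef_natr_div0 (m d : nat) : (0 < d)%N ->
  cf_coef (m%:R / d%:R : R) 0 = Some (m %/ d)%N%:Z.
Proof. by move=> d0; rewrite /cf_coef/= floor_natr_div. Qed.

(** One step of the expansion is one step of Euclid's algorithm, so the two
    can be followed in parallel. *)
Lemma cf_coef_natr_divS (m d i : nat) : (0 < d)%N ->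
  cf_coef (m%:R / d%:R : R) i.+1 =
  if (m %% d == 0)%N then None else cf_coef (d%:R / (m %% d)%N%:R : R) i.
Proof.
move=> d0; have dR : d%:R != 0 :> R by rewrite pnatr_eq0 -lt0n.
rewrite /cf_coef /complete_quotient iterSr /= frac_part_natr_div//.
rewrite mulf_eq0 invr_eq0 (negPf dR) orbF pnatr_eq0.
case: ifP => _; last by rewrite invf_div.
by set f := obind _; have -> : iter i f None = None by elim: i => //= i ->.
Qed.

End ContinuedFraction.

(** * The lattice and its bases *)

Definition in_lattice (n p : nat) (X Y : int) : Prop :=
  (n%:Z %| X - p%:Z * Y)%Z.

(** The wrapped point set becomes a genuine planar lattice, on which linear
    algebra applies. *)
Lemma periodize_rank1_lattice {R : realType} {n p : nat} {u : R * R} :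
  (0 < n)%N ->
  periodize (rank1_lattice R n p) u <->
  exists X Y : int, in_lattice n p X Y /\ u = (X%:~R / n%:R, Y%:~R / n%:R).
Proof.
move=> n0; have nR : n%:R != 0 :> R by rewrite pnatr_eq0 -lt0n.
have nZ : n%:Z != 0 by rewrite eqz_nat -lt0n.
split.
- case=> v [k kn <-] [a [b ->]].
  set f := Num.floor ((k * p)%N%:R / n%:R : R).
  exists ((k * p)%N%:Z + (a - f) * n%:Z), (k%:Z + b * n%:Z).
  split.
    apply/dvdzP; exists (a - f - p%:Z * b); rewrite PoszM; ring.
  rewrite /frac_part /= -/f.
  rewrite !(intrD, intrM, rmorphB, rmorphN) /= -!pmulrn.
  by congr pair; field.
- case=> X [Y [/dvdzP [z Xz] ->]].
  set k := `|(Y %% n)%Z|%N.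
  have kE : k%:Z = (Y %% n)%Z by rewrite gez0_abs// modz_ge0.
  have YE := divz_eq Y n; rewrite -kE in YE; set b := (Y %/ n)%Z in YE.
  set f := Num.floor ((k * p)%N%:R / n%:R : R).
  have kn : (k < n)%N by rewrite -ltz_nat kE ltz_pmod// ltz_nat.
  exists (frac_part ((k * p)%N%:R / n%:R), k%:R / n%:R); first by exists k.
  have -> : X = z * n%:Z + p%:Z * (b * n%:Z + k%:Z) by rewrite -YE -Xz; ring.
  exists (z + p%:Z * b + f), b; rewrite {1}YE /frac_part /= -/f.
  rewrite !(intrD, intrM) /= -!pmulrn natrM.
  by congr pair; field.
Qed.

Lemma in_latticeD {n p : nat} {X Y X' Y' : int} :
  in_lattice n p X Y -> in_lattice n p X' Y' ->
  in_lattice n p (X + X') (Y + Y').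
Proof.
move=> h h'; rewrite /in_lattice.
have -> : X + X' - p%:Z * (Y + Y') = (X - p%:Z * Y) + (X' - p%:Z * Y') by ring.
exact: rpredD.
Qed.

Lemma in_latticeZ {n p : nat} (i : int) {X Y : int} :
  in_lattice n p X Y -> in_lattice n p (i * X) (i * Y).
Proof.
move=> h; rewrite /in_lattice.
have -> : i * X - p%:Z * (i * Y) = i * (X - p%:Z * Y) by ring.
exact: dvdz_mull.
Qed.

(** [d], [d'] are consecutive remainders of Euclid's algorithm on
    [(n, p %% n)] and [q], [q'] the denominators of the corresponding
    convergents of [p / n].  The sign [e] alternates: convergents lie alternately
    on either side of [p / n]. *)
Record euclid_basis (n p d d' q q' : nat) : Prop := EuclidBasis {
  eb_det : (d * q' + d' * q)%N = n;
  eb_lt : (d' < d)%N;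
  eb_le : (q <= q')%N;
  eb_gt0 : (0 < q')%N;
  eb_coprime : coprime d d';
  eb_lattice : exists e : int, [/\ e * e = 1,
    in_lattice n p (e * d%:Z) q%:Z & in_lattice n p (- e * d'%:Z) q'%:Z]
}.

(** The algorithm starts from the conventional denominator [0], attached to the
    vector [(- n, 0)], and from the vector [(p %% n, 1)]. *)
Lemma euclid_basis0 {n p : nat} : (0 < n)%N -> coprime p n ->
  euclid_basis n p n (p %% n) 0 1.
Proof.
move=> n0 cop; split=> //.
- by rewrite muln1 muln0 addn0.
- exact: ltn_pmod.
- by rewrite coprime_modr coprime_sym.
- exists (-1); split=> //; rewrite /in_lattice.
    by apply/dvdzP; exists (-1); ring.
  apply/dvdzP; exists (- (p %/ n)%N%:Z).
  have := congr1 Posz (divn_eq p n); rewrite PoszD PoszM => pE.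
  by rewrite {1}pE; ring.
Qed.

Lemma euclid_basisS {n p d d' q q' : nat} : euclid_basis n p d d' q q' ->
  (0 < d')%N -> euclid_basis n p d' (d %% d') q' (q + d %/ d' * q').
Proof.
case=> det lt le q0 cop [e [ee L L']] d'0.
have dE := divn_eq d d'.
have c0 : (0 < d %/ d')%N by rewrite divn_gt0// ltnW.
split.
- by rewrite -det {3}dE; ring.
- exact: ltn_pmod.
- by rewrite (leq_trans _ (leq_addl _ _))// leq_pmull.
- by rewrite addn_gt0 muln_gt0 c0 q0 orbT.
- by rewrite coprime_modr coprime_sym.
- exists (- e); split=> //; first by rewrite mulrNN.
  rewrite opprK PoszD PoszM.
  have -> : e * (d %% d')%N%:Z
     = e * d%:Z + (d %/ d')%N%:Z * (- e * d'%:Z).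
    by rewrite {2}dE PoszD PoszM; ring.
  exact: in_latticeD L (in_latticeZ _ L').
Qed.

(** * Lattice points in boxes and empty boxes *)

Section Boxes.
Variables (R : realType).

(** Rounding the coordinates of the centre of the box in the basis [u], [v]
    moves it by at most half of each basis vector. *)
Lemma box_meets_basis (u v x y : R * R) :
  u.1 * v.2 - u.2 * v.1 != 0 ->
  `|u.1| + `|v.1| < y.1 - x.1 -> `|u.2| + `|v.2| < y.2 - x.2 ->
  exists i j : int,
    in_open_box x y (i%:~R * u.1 + j%:~R * v.1, i%:~R * u.2 + j%:~R * v.2).
Proof.
case: u v x y => [u1 u2] [v1 v2] [x1 x2] [y1 y2] /= det w1 w2.
(* [a], [b]: coordinates of the centre [(m1, m2)] by Cramer's rule. *)
pose D := u1 * v2 - u2 * v1.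
pose m1 := (x1 + y1) / 2; pose m2 := (x2 + y2) / 2.
pose a := (m1 * v2 - m2 * v1) / D; pose b := (m2 * u1 - m1 * u2) / D.
have E1 : m1 = a * u1 + b * v1 by rewrite /a /b /D; field.
have E2 : m2 = a * u2 + b * v2 by rewrite /a /b /D; field.
have near (t : R) : `|(Num.floor (t + 2^-1))%:~R - t| <= 2^-1.
  have /andP[] := floor_itv (t + 2^-1); rewrite intrD.
  by rewrite ler_norml => h1 h2; apply/andP; split; lra.
have round (t w : R) : `|((Num.floor (t + 2^-1))%:~R - t) * w| <= `|w| / 2.
  by rewrite normrM mulrC ler_wpM2l.
exists (Num.floor (a + 2^-1)), (Num.floor (b + 2^-1)).
have := round a u1; have := round b v1; have := round a u2; have := round b v2.
rewrite !ler_norml => /andP[h1 h2] /andP[h3 h4] /andP[h5 h6] /andP[h7 h8].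
by rewrite /in_open_box /=; move: E1 E2; rewrite /m1 /m2 => E1 E2; lra.
Qed.

(** The form [(X', Y') |-> X' * Y - Y' * X] takes multiples of [n] on the
    lattice.  The box below lies in the open strip where this form is strictly
    between [0] and [n]; its centre is the point of the strip's middle line on
    the first axis, which avoids distinguishing the signs of [X] and [Y]. *)
Lemma empty_periodic_box_of_vector {n p : nat} {X Y : int} : (0 < n)%N ->
  in_lattice n p X Y -> X != 0 -> Y != 0 ->
  exists x y : R * R, empty_periodic_box (rank1_lattice R n p) x y /\
    (y.1 - x.1) * (y.2 - x.2) = (4 * `|X|%:~R * `|Y|%:~R)^-1.
Proof.
move=> n0 /dvdzP [z Xz] X0 Y0.
have half (Z : int) : Z != 0 ->
    0 < (2 * `|Z|%:~R : R)^-1 <= 1 /\ 0 < `|Z|%:~R :> R.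
  move=> Z0; have Z1 : 1 <= `|Z|%:~R :> R by rewrite ler1z; lia.
  by split; [rewrite invr_gt0 invf_le1; lra | lra].
have [hX pX] := half X X0; have [hY pY] := half Y Y0.
have YR0 : Y%:~R != 0 :> R by rewrite intr_eq0.
have nR : n%:R != 0 :> R by rewrite pnatr_eq0 -lt0n.
pose s : R := (2 * Y%:~R)^-1.
pose g : R := (4 * `|Y|%:~R)^-1.
pose h : R := (4 * `|X|%:~R)^-1.
exists (s - g, - h), (s + g, h); split=> /=; last first.
  by rewrite /g /h; field; rewrite !lt0r_neq0.
rewrite /empty_periodic_box /=.
have -> : s + g - (s - g) = (2 * `|Y|%:~R)^-1.
  by rewrite /g; field; rewrite lt0r_neq0.
have -> : h - - h = (2 * `|X|%:~R)^-1.
  by rewrite /h; field; rewrite lt0r_neq0.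
split=> // _ /(periodize_rank1_lattice n0) [X' [Y' [/dvdzP [z' Xz'] ->]]].
case=> /= /andP[a1 a2] /andP[b1 b2].
set t1 : R := _ / _ in a1 a2; set t2 : R := _ / _ in b1 b2.
have A : `|t1 - s| < g by rewrite ltr_norml; lra.
have B : `|t2| < h by rewrite ltr_norml; lra.
(* [F] is the value of the form divided by [n]; it would be an integer in ]0, 1[. *)
pose F : int := z' * Y - z * Y'.
have FE : F%:~R = t1 * Y%:~R - t2 * X%:~R :> R.
  have XE : X = z * n%:Z + p%:Z * Y by rewrite -Xz; ring.
  have XE' : X' = z' * n%:Z + p%:Z * Y' by rewrite -Xz'; ring.
  rewrite /t1 /t2 XE XE' /F !(intrD, intrM, rmorphB) /= -!pmulrn.
  by field.
have A' : `|(t1 - s) * Y%:~R| < 4^-1.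
  by rewrite normrM -intr_norm -ltr_pdivlMr// -invfM.
have B' : `|t2 * X%:~R| < 4^-1.
  by rewrite normrM -intr_norm -ltr_pdivlMr// -invfM.
have sY : s * Y%:~R = 2^-1 by rewrite /s; field.
move: A' B'; rewrite !ltr_norml mulrBl sY => /andP[c1 c2] /andP[c3 c4].
have F0 : (0 : int)%:~R < F%:~R :> R by rewrite FE; lra.
have F1 : F%:~R < (1 : int)%:~R :> R by rewrite FE; lra.
by move: F0 F1; rewrite !ltr_int gtz0_ge1 leNgt => /negPf ->.
Qed.

(** The supremum is not a default value: side lengths at most [1] bound the
    areas. *)
Lemma periodic_dispersion_ge {P : set (R * R)} {x y : R * R} :
  empty_periodic_box P x y ->
  (y.1 - x.1) * (y.2 - x.2) <= periodic_dispersion P.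
Proof.
move=> e; apply: ub_le_sup; last by exists x, y.
exists 1 => _ [x' [y' [[/andP[a b] /andP[c d] _] ->]]].
by rewrite mulr_ile1// ltW.
Qed.

(** The opposite signs of [e * d] and [- e * d'] make the determinant of the
    basis [e * n], hence nonzero, so that [box_meets_basis] applies. *)
Lemma euclid_basis_box {n p d d' q q' : nat} {x y : R * R} : (0 < n)%N ->
  euclid_basis n p d d' q q' ->
  empty_periodic_box (rank1_lattice R n p) x y ->
  (y.1 - x.1) * n%:R <= (d + d')%N%:R \/ (y.2 - x.2) * n%:R <= (q + q')%N%:R.
Proof.
move=> n0 [det _ _ _ _ [e [ee L L']]] [_ _ empty].
have nR : 0 < n%:R :> R by rewrite ltr0n.
rewrite -!ler_pdivlMr//.
case: leP => [|hw]; first by left.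
case: leP => [|hh]; first by right.
exfalso.
pose u : R * R := ((e * d%:Z)%:~R / n%:R, q%:R / n%:R).
pose v : R * R := ((- e * d'%:Z)%:~R / n%:R, q'%:R / n%:R).
have e1 : `|e%:~R| = 1 :> R.
  by apply/eqP; rewrite -sqrp_eq1// -normrX expr2 -intrM ee normr1.
have ni : `|n%:R^-1| = n%:R^-1 :> R by rewrite ger0_norm// invr_ge0 ltW.
have [|||i [j]] := @box_meets_basis u v x y.
- apply/negP => /eqP /=; rewrite !(intrM, intrN) -!pmulrn => D0.
  have : e%:~R * n%:R = 0 :> R.
    have -> : e%:~R * n%:R = n%:R ^+ 2 * (e%:~R * d%:R / n%:R * (q'%:R / n%:R) -
      q%:R / n%:R * (- e%:~R * d'%:R / n%:R)) :> R.
      by rewrite -[in LHS]det natrD !natrM; field; rewrite lt0r_neq0.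
    by rewrite D0 mulr0.
  by move/eqP; rewrite mulf_eq0 -normr_eq0 e1 oner_eq0 (gt_eqF nR).
- by rewrite /= !(intrM, intrN) -!pmulrn !normrM normrN e1 ni !mul1r !normr_nat
    -mulrDl -natrD.
- by rewrite /= !normrM ni !normr_nat -mulrDl -natrD.
apply: empty; apply/(periodize_rank1_lattice n0).
exists (i * (e * d%:Z) + j * (- e * d'%:Z)), (i * q%:Z + j * q'%:Z); split.
  exact: in_latticeD (in_latticeZ _ L) (in_latticeZ _ L').
by rewrite /u /v /= !intrD !(intrM _ i) !(intrM _ j) -!pmulrn !mulrDl !mulrA.
Qed.

(** * The two implications *)

(** Induction along Euclid's algorithm.  As long as the next basis also
    satisfies the bound on the width, pass to it; at the first step where it
    does not, the next basis bounds the height, and the product of the two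
    bounds is controlled by [d * q' <= n]. *)
Lemma empty_box_area_le {n p d d' q q' : nat} {K : R} {x y : R * R} :
  (0 < n)%N -> 0 <= K ->
  euclid_basis n p d d' q q' ->
  ((0 < d')%N -> forall i c,
     cf_coef (d%:R / d'%:R : R) i = Some c -> c%:~R <= K) ->
  empty_periodic_box (rank1_lattice R n p) x y ->
  (y.1 - x.1) * n%:R <= (d + d')%N%:R ->
  ((y.1 - x.1) * n%:R) * ((y.2 - x.2) * n%:R) <= 2 * (K + 2) * n%:R.
Proof.
move=> n0 K0 + + e.
have nR : 0 < n%:R :> R by rewrite ltr0n.
have [/andP[w0 w1] /andP[h0 h1] _] := e.
set w := y.1 - x.1 in w0 w1 *; set h := y.2 - x.2 in h0 h1 *.
have hn0 : 0 <= h * n%:R by rewrite mulr_ge0// ltW.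
have wn0 : 0 <= w * n%:R by rewrite mulr_ge0// ltW.
elim/ltn_ind: d' d q q' => d' IH d q q' B cf wd.
have [det lt le _ cop _] := B.
have [d'0|d'0] := posnP d'.
  (* The algorithm has stopped at the gcd: the width is at most [1 / n], and the
     bound [h <= 1] on the height suffices. *)
  have d1 : d = 1%N by move: cop; rewrite d'0 /coprime gcdn0 => /eqP.
  rewrite d1 d'0 addn0 in wd.
  apply: (@le_trans _ _ (1 * n%:R)); last by rewrite ler_wpM2r//; lra.
  by apply: ler_pM => //; rewrite ger_pMl.
have B' := euclid_basisS B d'0.
have [wd'|qh] := euclid_basis_box n0 B' e.
  apply: (IH _ _ _ _ _ B') => // [|m0 i c ci]; first exact: ltn_pmod.
  by apply: (cf d'0 i.+1); rewrite cf_coef_natr_divS// gtn_eqF.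
have cK : (d %/ d')%N%:R <= K by rewrite pmulrn; apply: (cf d'0 0%N); rewrite cf_coef_natr_div0.
have ltR : d'%:R <= d%:R :> R by rewrite ler_nat ltnW.
have leR : q%:R <= q'%:R :> R by rewrite ler_nat.
have detR : d%:R * q'%:R <= n%:R :> R.
  by rewrite -natrM ler_nat -det leq_addr.
have w2 : w * n%:R <= 2 * d%:R by apply: le_trans wd _; rewrite natrD; lra.
have h2 : h * n%:R <= (K + 2) * q'%:R.
  apply: le_trans qh _; rewrite !natrD natrM.
  have : (d %/ d')%N%:R * q'%:R <= K * q'%:R by rewrite ler_wpM2r.
  lra.
apply: le_trans (ler_pM wn0 hn0 w2 h2) _.
have -> : 2 * d%:R * ((K + 2) * q'%:R) = 2 * (K + 2) * (d%:R * q'%:R) :> R by ring.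
by rewrite ler_wpM2l//; lra.
Qed.

Lemma periodic_dispersion_le (n p : nat) (K : R) : (0 < n)%N -> coprime p n ->
  0 <= K ->
  (forall i c, cf_coef (p%:R / n%:R : R) i = Some c -> c%:~R <= K) ->
  periodic_dispersion (rank1_lattice R n p) <= 2 * (K + 2) / n%:R.
Proof.
move=> n0 cop K0 cf.
have nR : 0 < n%:R :> R by rewrite ltr0n.
apply: ge_sup.
  (* [ge_sup] requires some empty box; [(n, n)] is a lattice vector. *)
  have nZ : n%:Z != 0 by rewrite eqz_nat -lt0n.
  have L : in_lattice n p n n by apply/dvdzP; exists (1 - p%:Z); ring.
  have [x [y [e a]]] := empty_periodic_box_of_vector n0 L nZ nZ.
  by eexists; exists x, y.
move=> _ [x [y [e ->]]].
have [/andP[_ w1] _ _] := e.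
have first_width : (y.1 - x.1) * n%:R <= (n + p %% n)%N%:R.
  by apply: (@le_trans _ _ n%:R); rewrite ?ler_nat ?leq_addr// ger_pMl.
have scaled_area : ((y.1 - x.1) * n%:R) * ((y.2 - x.2) * n%:R)
    <= 2 * (K + 2) * n%:R.
  apply: (empty_box_area_le n0 K0 (euclid_basis0 n0 cop)) => // pn0 i c ci.
  by apply: (cf i.+1); rewrite cf_coef_natr_divS// gtn_eqF.
rewrite ler_pdivlMr// -(ler_pM2r nR).
by move: scaled_area; congr (_ <= _); ring.
Qed.

(** Every coefficient of index [i] is the leading quotient of the basis reached
    after [i] steps, and the vector [(- e * d', q')] of that basis yields an
    empty box of area at least a quarter of the quotient, divided by [n]. *)
Lemma cf_coef_euclid_basis_lt {n p : nat} {C : R} : (0 < n)%N ->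
  periodic_dispersion (rank1_lattice R n p) < C / n%:R ->
  forall {i d d' q q' : nat} {c : int}, euclid_basis n p d d' q q' ->
  (0 < d')%N -> cf_coef (d%:R / d'%:R : R) i = Some c -> c%:~R < 4 * C.
Proof.
move=> n0 disp; elim=> [|i IH] d d' q q' c B d'0; last first.
  rewrite cf_coef_natr_divS//; case: eqP => // /eqP m0.
  by apply: IH (euclid_basisS B d'0) _; rewrite lt0n.
rewrite cf_coef_natr_div0// => -[<-].
have [det _ _ q0 _ [e [ee _ L]]] := B.
have nR : 0 < n%:R :> R by rewrite ltr0n.
have e1 : `|e| = 1 by apply/eqP; rewrite -sqrp_eq1// -normrX expr2 ee normr1.
have nX : `|- e * d'%:Z| = d'%:Z by rewrite normrM normrN e1 mul1r.
have X0 : - e * d'%:Z != 0 by rewrite -normr_eq0 nX; lia.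
have Y0 : q'%:Z != 0 by lia.
have [x [y [empty area]]] := empty_periodic_box_of_vector n0 L X0 Y0.
have := le_lt_trans (periodic_dispersion_ge empty) disp.
have dq : 0 < 4 * d'%:R * q'%:R :> R by rewrite !mulr_gt0 ?ltr0n.
rewrite area nX -!pmulrn ltr_pdivlMr// mulrC ltr_pdivrMr// => nlt.
have dq' : 0 < d'%:R * q'%:R :> R by rewrite mulr_gt0 ?ltr0n.
rewrite -(ltr_pM2r dq').
apply: le_lt_trans (_ : n%:R < _); last by apply: lt_le_trans nlt _; lra.
rewrite mulrA -!natrM ler_nat -det.
by rewrite (leq_trans _ (leq_addr _ _))// leq_mul2r leq_divM orbT.
Qed.

End Boxes.

Theorem theorem6p6 (R : realType) :
  (exists A : R, forall N : nat, (0 < N)%N ->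
     exists a : nat, [/\ (0 < a)%N, coprime a N &
       forall (i : nat) (c : int),
         cf_coef (a%:R / N%:R : R) i = Some c -> c%:~R < A])
  <->
  (exists C : R, 0 < C /\ forall n : nat, (0 < n)%N ->
     exists p : nat, [/\ (0 < p)%N, coprime p n &
       periodic_dispersion (rank1_lattice R n p) < C / n%:R]).
Proof.
split=> [[A zaremba]|[C [C0 disp]]].
- have A0 : 0 <= `|A| by [].
  exists (2 * (`|A| + 2) + 1); split=> [|n n0]; first by lra.
  have nR : 0 < n%:R :> R by rewrite ltr0n.
  have [a [a0 cop cf]] := zaremba n n0; exists a; split=> //.
  apply: (@le_lt_trans _ _ (2 * (`|A| + 2) / n%:R)).
    apply: periodic_dispersion_le => // i c /cf /ltW /le_trans; apply.
    exact: ler_norm.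
  by rewrite ltr_pM2r ?invr_gt0//; lra.
(* Replacing [p] by [p %% n + n] keeps the numerator positive even for
     [n = 1] and makes the coefficient of index 0 equal to 1; the others are
     those of [p / n]. *)
- exists (4 * C + 2) => n n0; have [p [p0 cop lt]] := disp n n0.
  have mE : ((p %% n + n) %% n = p %% n)%N by rewrite modnDr modn_mod.
  exists (p %% n + n)%N; split; first by rewrite addn_gt0 n0 orbT.
    by rewrite -coprime_modl mE coprime_modl.
  case=> [|i] c.
    rewrite cf_coef_natr_div0// divnDr// divnn n0 divn_small ?ltn_pmod//.
    by move=> [<-]; rewrite -pmulrn; lra.
  rewrite cf_coef_natr_divS// mE; case: eqP => // /eqP m0 ci.
  have m1 : (0 < p %% n)%N by rewrite lt0n.
  have := cf_coef_euclid_basis_lt _ n0 lt (euclid_basis0 n0 cop) m1 ci.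
  lra.
Qed.
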